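(* Let $G$ be a finite abelian group. Let $(M_1,\varepsilon_1)$ be a $G$-span from $S_1\xrightarrow{H_1}BG$ to $T\xrightarrow{V_1}BG$, with functors $L_1\colon M_1\to S_1$, $R_1\colon M_1\to T$, and let $(M_2,\varepsilon_2)$ be a $G$-span from $T\xrightarrow{H_2}BG$ to $S_2\xrightarrow{V_2}BG$, with functors $L_2\colon M_2\to T$, $R_2\colon M_2\to S_2$, and suppose that $V_1=H_2\colon T\to BG$, so that the two $G$-spans are composable. Then the matrix of the composite $G$-span $(M_1\times_T M_2,\varepsilon_1\times_T\varepsilon_2)$ is the matrix product $$[M_1\times_T M_2,\ \varepsilon_1\times_T\varepsilon_2]=[M_1,\varepsilon_1]\,[M_2,\varepsilon_2],$$ that is, for all $c_1\in\pi_0(S_1)$ and $c_2\in\pi_0(S_2)$, $[M_1\times_T M_2,\varepsilon_1\times_T\varepsilon_2](c_1,c_2)=\sum_{d\in\pi_0(T)}[M_1,\varepsilon_1](c_1,d)\,[M_2,\varepsilon_2](d,c_2)$ in $\mathbf{Q}G$.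
   Context: $\mathbf{Q}G$ is the rational group ring of $G$, and $BG$ is the groupoid with a single object $\bullet$ and automorphism group $G$. A finite groupoid has finitely many objects and morphisms. For a groupoid $S$, $S(a,b)$ is the set of morphisms from $a$ to $b$, and $\pi_0(S)$ is the set of isomorphism classes of objects; a representative object is fixed in each class and the same letter denotes a class and its representative (the same choice is used in all matrices occurring). The Euler characteristic of a finite groupoid is $\chi(S)=\sum_{c\in\pi_0(S)}|S(c,c)|^{-1}$. For an object $d$ of $T$, $T\{d\}$ is the full subgroupoid of $T$ on the object $d$, so $\chi(T\{d\})=|T(d,d)|^{-1}$. For a function $\varepsilon\colon\mathrm{Ob}(T)\to Y$ and $y\in Y$, $T\{\varepsilon=y\}$ is the full subgroupoid of $T$ on the objects in $\varepsilon^{-1}(y)$. $G$-span: a $G$-span $(M,\varepsilon)$ from $S\xrightarrow{H}BG$ to $T\xrightarrow{V}BG$ with apex $M$ consists of finite groupoids $S,T,M$, functors $H\colon S\to BG$, $V\colon T\to BG$, $L\colon M\to S$, $R\colon M\to T$, and a function $\varepsilon\colon\mathrm{Ob}(M)\to G$ that is a natural transformation $HL\Rightarrow VR$, i.e. $\varepsilon(a_2)\,(HL)(m)=(VR)(m)\,\varepsilon(a_1)$ in $G$ for all $m\in M(a_1,a_2)$. Two-sided homotopy fibre: for $c\in\mathrm{Ob}(S)$, $d\in\mathrm{Ob}(T)$, the groupoid $c\backslash M/d$ has as objects all triples $(s,a,t)$ with $a\in\mathrm{Ob}(M)$, $s\in S(c,La)$, $t\in T(Ra,d)$; a morphism $(s_1,a_1,t_1)\to(s_2,a_2,t_2)$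 is an $m\in M(a_1,a_2)$ with $L(m)s_1=s_2$ and $t_1=t_2R(m)$. The function $c\backslash\varepsilon/d\colon\mathrm{Ob}(c\backslash M/d)\to G$ is $(c\backslash\varepsilon/d)(s,a,t)=V(t)\varepsilon(a)H(s)$. Matrix of a $G$-span: $[M,\varepsilon]\colon\pi_0(S)\times\pi_0(T)\to\mathbf{Q}G$ is $$[M,\varepsilon](c,d)=\sum_{g\in G}\chi\big((c\backslash M/d)\{c\backslash\varepsilon/d=g\}\big)\,\chi(T\{d\})\,g.$$ Composition: $M_1\times_T M_2$ is the homotopy pull-back groupoid, whose objects are triples $(a_1,t,a_2)$ with $a_i\in\mathrm{Ob}(M_i)$ and $t\in T(R_1a_1,L_2a_2)$, and whose morphisms $(a_1,t,a_2)\to(b_1,u,b_2)$ are pairs $(m_1,m_2)\in M_1(a_1,b_1)\times M_2(a_2,b_2)$ with $u\,R_1(m_1)=L_2(m_2)\,t$. With projections $p_i\colon M_1\times_TM_2\to M_i$, the composite $G$-span from $S_1\xrightarrow{H_1}BG$ to $S_2\xrightarrow{V_2}BG$ has apex $M_1\times_TM_2$, functors $L_1p_1$ and $R_2p_2$, and natural transformation $(\varepsilon_1\times_T\varepsilon_2)(a_1,t,a_2)=\varepsilon_2(a_2)V_1(t)\varepsilon_1(a_1)$. *)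

(* Defs.v *)
From HB Require Import structures.
From mathcomp Require Import all_boot all_order all_algebra all_fingroup.
Set Implicit Arguments.
Unset Strict Implicit.
Unset Printing Implicit Defensive.
Import GRing.Theory.

(* Finite groupoids. [gcomp g f] is the composite "g after f". *)
Record finGroupoid := FinGroupoid {
  Ob :> finType;
  hom : Ob -> Ob -> finType;
  gid : forall a, hom a a;
  gcomp : forall a b c, hom b c -> hom a b -> hom a c;
  ginv : forall a b, hom a b -> hom b a;
  gcompA : forall a b c d (h : hom c d) (g : hom b c) (f : hom a b),
    gcomp h (gcomp g f) = gcomp (gcomp h g) f;
  gcomp1m : forall a b (f : hom a b), gcomp (gid b) f = f;
  gcompm1 : forall a b (f : hom a b), gcomp f (gid a) = f;
  gcompVm : forall a b (f : hom a b), gcomp (ginv f) f = gid a;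
  gcompmV : forall a b (f : hom a b), gcomp f (ginv f) = gid b
}.
Arguments hom {S} a b : rename.
Arguments gid {S} a : rename.
Arguments gcomp {S a b c} g f : rename.
Arguments ginv {S a b} f : rename.

Declare Scope groupoid_scope.
Delimit Scope groupoid_scope with gpd.
Notation "g '\oo' f" := (gcomp g f)
  (at level 40, left associativity) : groupoid_scope.
Local Open Scope groupoid_scope.

Record functor (S T : finGroupoid) := Functor {
  fob :> S -> T;
  fmap : forall a b : S, hom a b -> hom (fob a) (fob b);
  fmap_id : forall a : S, fmap (gid a) = gid (fob a);
  fmap_comp : forall (a b c : S) (g : hom b c) (f : hom a b),
    fmap (g \oo f) = fmap g \oo fmap f
}.
Arguments fmap {S T} F {a b} f : rename.

Section FunctorComp.
Variables (S T U : finGroupoid) (F : functor T U) (K : functor S T).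

Lemma comp_fmap_id (a : S) : fmap F (fmap K (gid a)) = gid (F (K a)).
Proof. by rewrite !fmap_id. Qed.

Lemma comp_fmap_comp (a b c : S) (g : hom b c) (f : hom a b) :
  fmap F (fmap K (g \oo f)) = fmap F (fmap K g) \oo fmap F (fmap K f).
Proof. by rewrite !fmap_comp. Qed.

Definition functor_comp : functor S U :=
  @Functor S U (fun a => F (K a)) (fun a b f => fmap F (fmap K f))
    comp_fmap_id comp_fmap_comp.
End FunctorComp.

(* The one-object groupoid BG; composition is [g \oo f = g * f]. *)
Definition BG (gT : finGroupType) : finGroupoid :=
  @FinGroupoid unit (fun _ _ => gT) (fun _ => 1%g)
    (fun _ _ _ g f => (g * f)%g) (fun _ _ g => (g^-1)%g)
    (fun _ _ _ _ => @mulgA gT) (fun _ _ => @mul1g gT) (fun _ _ => @mulg1 gT)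
    (fun _ _ => @mulVg gT) (fun _ _ => @mulgV gT).

Section Iso.
Variable S : finGroupoid.

(* All morphisms being invertible, two objects are isomorphic as soon as
   there is a morphism between them. *)
Definition isob (a b : S) : bool := [exists f : hom a b, true].

Lemma isob_refl : reflexive isob.
Proof. by move=> a; apply/existsP; exists (gid a). Qed.

Lemma isob_sym : symmetric isob.
Proof.
by move=> a b; apply/existsP/existsP => -[f _]; exists (ginv f).
Qed.

Lemma isob_trans : transitive isob.
Proof.
move=> b a c /existsP[f _] /existsP[g _].
by apply/existsP; exists (g \oo f).
Qed.

Canonical isob_equiv := EquivRel isob isob_refl isob_sym isob_trans.

End Iso.

Definition pi0 (S : finGroupoid) : Type := {eq_quot @isob S}%qT.
HB.instance Definition _ (S : finGroupoid) :=
  Quotient.copy (pi0 S) {eq_quot @isob S}%qT.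
HB.instance Definition _ (S : finGroupoid) := [Finite of pi0 S by <:%/].

Lemma pi0_eq_quot (S : finGroupoid) :
  {mono \pi_(pi0 S)%qT : a b / isob a b >-> a == b}.
Proof.
move=> a b /=; apply/eqP/idP => [/(@eqquotP _ _ {eq_quot @isob S}%qT)//|ab].
exact/(@eqquotP _ _ {eq_quot @isob S}%qT).
Qed.

HB.instance Definition _ (S : finGroupoid) :=
  isEqQuotient.Build S (@isob S) (pi0 S) (@pi0_eq_quot S).

Section Pi0.
Variable S : finGroupoid.

Record pi0_reps := Pi0Reps {
  rep :> pi0 S -> S;
  repK : forall c : pi0 S, (\pi_(pi0 S) (rep c))%qT = c
}.

(* The Euler characteristic does not depend on the representatives;
   those provided by the quotient type are used. *)
Definition chi : rat :=
  (\sum_(c : pi0 S) let a : S := generic_quotient.repr c in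
     (#|hom a a|%:R)^-1)%R.

Lemma card_aut (a b : S) : isob a b -> #|hom a a| = #|hom b b|.
Proof.
case/existsP=> f _; apply: (@bij_eq_card _ _ (fun g => f \oo g \oo ginv f)).
exists (fun h => ginv f \oo h \oo f) => g.
  by rewrite -!gcompA gcompVm gcompm1 gcompA gcompVm gcomp1m.
by rewrite -!gcompA gcompmV gcompm1 gcompA gcompmV gcomp1m.
Qed.

Lemma chi_reps (r : pi0_reps) :
  chi = (\sum_(c : pi0 S) (#|hom (r c) (r c)|%:R)^-1)%R.
Proof.
apply: eq_bigr => c _ /=; congr (_%:R^-1)%R; apply: card_aut.
by rewrite -(pi0_eq_quot (S := S)) reprK repK.
Qed.
End Pi0.

Section FullSub.
Variables (T : finGroupoid) (P : pred T).
Let ob : finType := {a : T | P a}.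
Let sub_hom (a b : ob) : finType := hom (val a) (val b).

Definition fullsub : finGroupoid :=
  @FinGroupoid ob sub_hom (fun a => gid (val a))
    (fun _ _ _ g f => g \oo f) (fun _ _ f => ginv f)
    (fun _ _ _ _ h g f => gcompA h g f)
    (fun _ _ f => gcomp1m f) (fun _ _ f => gcompm1 f)
    (fun _ _ f => gcompVm f) (fun _ _ f => gcompmV f).
End FullSub.

(* T{d} *)
Definition obj_sub (T : finGroupoid) (d : T) : finGroupoid :=
  fullsub (pred1 d).

(* T{e = y} *)
Definition level_sub (T : finGroupoid) (Y : eqType) (e : T -> Y) (y : Y) :
  finGroupoid := fullsub [pred a | e a == y].

Section TwoSidedFibre.
Variables (S T M : finGroupoid) (L : functor M S) (R : functor M T).
Variables (c : S) (d : T).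

(* The triple (s, a, t) is encoded as [Tagged _ (s, t)] with tag a. *)
Definition hofib_ob : finType := {a : M & (hom c (L a) * hom (R a) d)%type}.
Definition hofib_s (x : hofib_ob) : hom c (L (tag x)) := (tagged x).1.
Definition hofib_t (x : hofib_ob) : hom (R (tag x)) d := (tagged x).2.

Definition hofib_mor (x y : hofib_ob) (m : hom (tag x) (tag y)) : bool :=
  (fmap L m \oo hofib_s x == hofib_s y)
  && (hofib_t x == hofib_t y \oo fmap R m).

Definition hofib_hom (x y : hofib_ob) : finType :=
  {m : hom (tag x) (tag y) | hofib_mor m}.

Lemma hofib_id_subproof (x : hofib_ob) :
  @hofib_mor x x (gid (tag x)).
Proof. by rewrite /hofib_mor !fmap_id gcomp1m gcompm1 !eqxx. Qed.

Lemma hofib_comp_subproof (x y z : hofib_ob)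
    (n : hofib_hom y z) (m : hofib_hom x y) :
  @hofib_mor x z (val n \oo val m).
Proof.
case: n m => n /= /andP[/eqP nL /eqP nR] [m /= /andP[/eqP mL /eqP mR]].
by rewrite /hofib_mor !fmap_comp -gcompA mL nL gcompA -nR -mR !eqxx.
Qed.

Lemma hofib_inv_subproof (x y : hofib_ob) (m : hofib_hom x y) :
  @hofib_mor y x (ginv (val m)).
Proof.
case: m => m /= /andP[/eqP mL /eqP mR].
rewrite /hofib_mor -mL mR gcompA -fmap_comp gcompVm fmap_id gcomp1m eqxx /=.
by rewrite -gcompA -fmap_comp gcompmV fmap_id gcompm1.
Qed.

Definition hofib_id x : hofib_hom x x :=
  exist (@hofib_mor x x) _ (hofib_id_subproof x).
Definition hofib_comp x y z n m : hofib_hom x z :=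
  exist (@hofib_mor x z) _ (@hofib_comp_subproof x y z n m).
Definition hofib_inv x y m : hofib_hom y x :=
  exist (@hofib_mor y x) _ (@hofib_inv_subproof x y m).

Lemma hofib_compA x y z w
    (h : hofib_hom z w) (g : hofib_hom y z) (f : hofib_hom x y) :
  hofib_comp h (hofib_comp g f) = hofib_comp (hofib_comp h g) f.
Proof. by apply/val_inj/gcompA. Qed.
Lemma hofib_comp1m x y (f : hofib_hom x y) : hofib_comp (hofib_id y) f = f.
Proof. by apply/val_inj/gcomp1m. Qed.
Lemma hofib_compm1 x y (f : hofib_hom x y) : hofib_comp f (hofib_id x) = f.
Proof. by apply/val_inj/gcompm1. Qed.
Lemma hofib_compVm x y (f : hofib_hom x y) :
  hofib_comp (hofib_inv f) f = hofib_id x.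
Proof. by apply/val_inj/gcompVm. Qed.
Lemma hofib_compmV x y (f : hofib_hom x y) :
  hofib_comp f (hofib_inv f) = hofib_id y.
Proof. by apply/val_inj/gcompmV. Qed.

(* The groupoid c\M/d. *)
Definition hofib : finGroupoid :=
  FinGroupoid hofib_compA hofib_comp1m hofib_compm1 hofib_compVm hofib_compmV.
End TwoSidedFibre.

Section HomotopyPullback.
Variables (T M1 M2 : finGroupoid) (R1 : functor M1 T) (L2 : functor M2 T).

(* The triple (a1, t, a2) is encoded as [Tagged _ t] with tag (a1, a2). *)
Definition hopb_ob : finType := {a : M1 * M2 & hom (R1 a.1) (L2 a.2)}.
Definition hopb_1 (x : hopb_ob) : M1 := (tag x).1.
Definition hopb_2 (x : hopb_ob) : M2 := (tag x).2.
Definition hopb_t (x : hopb_ob) : hom (R1 (hopb_1 x)) (L2 (hopb_2 x)) :=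
  tagged x.

Definition hopb_mor (x y : hopb_ob)
    (m : hom (hopb_1 x) (hopb_1 y) * hom (hopb_2 x) (hopb_2 y)) : bool :=
  hopb_t y \oo fmap R1 m.1 == fmap L2 m.2 \oo hopb_t x.

Definition hopb_hom (x y : hopb_ob) : finType :=
  {m : hom (hopb_1 x) (hopb_1 y) * hom (hopb_2 x) (hopb_2 y) | hopb_mor m}.

Lemma hopb_id_subproof (x : hopb_ob) :
  @hopb_mor x x (gid (hopb_1 x), gid (hopb_2 x)).
Proof. by rewrite /hopb_mor !fmap_id gcomp1m gcompm1. Qed.

Lemma hopb_comp_subproof (x y z : hopb_ob)
    (n : hopb_hom y z) (m : hopb_hom x y) :
  @hopb_mor x z ((val n).1 \oo (val m).1, (val n).2 \oo (val m).2).
Proof.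
case: n m => n /= /eqP nE [m /= /eqP mE].
by rewrite /hopb_mor /= !fmap_comp gcompA nE -gcompA mE gcompA.
Qed.

Lemma hopb_inv_subproof (x y : hopb_ob) (m : hopb_hom x y) :
  @hopb_mor y x (ginv (val m).1, ginv (val m).2).
Proof.
case: m => m /= /eqP mE; apply/eqP => /=.
rewrite -[LHS]gcomp1m -(fmap_id L2) -(gcompVm m.2) fmap_comp -gcompA.
rewrite [fmap L2 m.2 \oo _]gcompA -mE -gcompA -fmap_comp gcompmV fmap_id.
by rewrite gcompm1.
Qed.

Definition hopb_id x : hopb_hom x x :=
  exist (@hopb_mor x x) (gid (hopb_1 x), gid (hopb_2 x)) (hopb_id_subproof x).
Definition hopb_comp x y z (n : hopb_hom y z) (m : hopb_hom x y) :
    hopb_hom x z :=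
  exist (@hopb_mor x z) ((val n).1 \oo (val m).1, (val n).2 \oo (val m).2)
    (hopb_comp_subproof n m).
Definition hopb_inv x y (m : hopb_hom x y) : hopb_hom y x :=
  exist (@hopb_mor y x) (ginv (val m).1, ginv (val m).2) (hopb_inv_subproof m).

Lemma hopb_compA x y z w
    (h : hopb_hom z w) (g : hopb_hom y z) (f : hopb_hom x y) :
  hopb_comp h (hopb_comp g f) = hopb_comp (hopb_comp h g) f.
Proof. by apply/val_inj; congr pair; apply: gcompA. Qed.
Lemma hopb_comp1m x y (f : hopb_hom x y) : hopb_comp (hopb_id y) f = f.
Proof. by apply/val_inj; rewrite /= !gcomp1m -surjective_pairing. Qed.
Lemma hopb_compm1 x y (f : hopb_hom x y) : hopb_comp f (hopb_id x) = f.
Proof. by apply/val_inj; rewrite /= !gcompm1 -surjective_pairing. Qed.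
Lemma hopb_compVm x y (f : hopb_hom x y) :
  hopb_comp (hopb_inv f) f = hopb_id x.
Proof. by apply/val_inj; rewrite /= !gcompVm. Qed.
Lemma hopb_compmV x y (f : hopb_hom x y) :
  hopb_comp f (hopb_inv f) = hopb_id y.
Proof. by apply/val_inj; rewrite /= !gcompmV. Qed.

Definition hopb : finGroupoid :=
  FinGroupoid hopb_compA hopb_comp1m hopb_compm1 hopb_compVm hopb_compmV.

Definition hopb_p1 : functor hopb M1 :=
  @Functor hopb M1 hopb_1 (fun x y (m : hopb_hom x y) => (val m).1)
    (fun _ => erefl) (fun _ _ _ _ _ => erefl).
Definition hopb_p2 : functor hopb M2 :=
  @Functor hopb M2 hopb_2 (fun x y (m : hopb_hom x y) => (val m).2)
    (fun _ => erefl) (fun _ _ _ _ _ => erefl).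
End HomotopyPullback.

Section GSpan.
Variable gT : finGroupType.

(* [eps_nat] says that eps is a natural transformation H L => V R. *)
Record gspan (S T : finGroupoid) (H : functor S (BG gT))
    (V : functor T (BG gT)) := GSpan {
  apex :> finGroupoid;
  legL : functor apex S;
  legR : functor apex T;
  eps : apex -> gT;
  eps_nat : forall (a1 a2 : apex) (m : hom a1 a2),
    (eps a2 * fmap (functor_comp H legL) m)%g
      = (fmap (functor_comp V legR) m * eps a1)%g
}.

Section Composition.
Variables (S1 T S2 : finGroupoid) (H1 : functor S1 (BG gT)).
Variables (V1 : functor T (BG gT)) (V2 : functor S2 (BG gT)).
Variables (M1 : gspan H1 V1) (M2 : gspan V1 V2).

Definition gspan_comp_eps (x : hopb (legR M1) (legL M2)) : gT :=
  (eps (hopb_2 x) * fmap V1 (hopb_t x) * eps (hopb_1 x))%g.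

Lemma gspan_comp_nat (x y : hopb (legR M1) (legL M2)) (m : hom x y) :
  (gspan_comp_eps y
     * fmap (functor_comp H1 (functor_comp (legL M1) (hopb_p1 _ _))) m)%g
  = (fmap (functor_comp V2 (functor_comp (legR M2) (hopb_p2 _ _))) m
     * gspan_comp_eps x)%g.
Proof.
case: m => -[m1 m2] /= mP; have /= mE := congr1 (fmap V1) (eqP mP).
rewrite !fmap_comp /= in mE; rewrite /gspan_comp_eps.
have /= e1 := eps_nat m1; have /= e2 := eps_nat m2.
by rewrite -mulgA e1 !mulgA -e2 -!mulgA; congr (_ * _)%g; rewrite !mulgA mE.
Qed.

Definition gspan_comp : gspan H1 V2 := GSpan gspan_comp_nat.
End Composition.
End GSpan.

Local Open Scope ring_scope.

(* The rational group ring: functions gT -> rat with convolution. *)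
Definition QG (gT : finGroupType) := {ffun gT -> rat^o}.

Section GroupRing.
Variable gT : finGroupType.
Local Notation QG := (QG gT).

HB.instance Definition _ := GRing.Lmodule.on QG.

Definition qg (g : gT) : QG := [ffun x => (x == g)%:R].
Definition qg_mul (u v : QG) : QG :=
  [ffun x => \sum_(y : gT) (u y : rat) * v (y^-1 * x)%g].

Lemma qg_mulA : associative qg_mul.
Proof.
move=> u v w; apply/ffunP => x; rewrite !ffunE.
under eq_bigr do rewrite ffunE mulr_sumr.
under [RHS]eq_bigr do rewrite ffunE mulr_suml.
rewrite [RHS]exchange_big; apply: eq_bigr => y _ /=.
rewrite [RHS](reindex_inj (mulgI y)) /=; apply: eq_bigr => z _.
by rewrite mulKg mulrA invMg mulgA.
Qed.

Lemma qg_mul1 : left_id (qg 1%g) qg_mul.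
Proof.
move=> u; apply/ffunP => x; rewrite ffunE (bigD1 1%g) //= big1 ?addr0.
  by rewrite ffunE eqxx mul1r invg1 mul1g.
by move=> y /negPf y1; rewrite ffunE y1 mul0r.
Qed.

Lemma qg_mulr1 : right_id (qg 1%g) qg_mul.
Proof.
move=> u; apply/ffunP => x; rewrite ffunE (bigD1 x) //= big1 ?addr0.
  by rewrite ffunE mulVg eqxx mulr1.
move=> y /negPf yx; rewrite ffunE -(inj_eq (mulgI y)) mulKVg mulg1 eq_sym yx.
by rewrite mulr0.
Qed.

Lemma qg_mulDl : left_distributive qg_mul +%R.
Proof.
move=> u v w; apply/ffunP => x; rewrite !ffunE -big_split /=.
by apply: eq_bigr => y _; rewrite ffunE mulrDl.
Qed.

Lemma qg_mulDr : right_distributive qg_mul +%R.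
Proof.
move=> u v w; apply/ffunP => x; rewrite !ffunE -big_split /=.
by apply: eq_bigr => y _; rewrite ffunE mulrDr.
Qed.

Lemma qg1_neq0 : qg 1%g != 0.
Proof. by apply/eqP => /ffunP/(_ 1%g); rewrite !ffunE eqxx. Qed.

HB.instance Definition _ := GRing.Zmodule_isNzRing.Build QG
  qg_mulA qg_mul1 qg_mulr1 qg_mulDl qg_mulDr qg1_neq0.

Lemma qg_scaleAl (a : rat) (u v : QG) : a *: (u * v) = (a *: u) * v.
Proof.
apply/ffunP => x; rewrite !ffunE scaler_sumr; apply: eq_bigr => y _.
by rewrite ffunE -mulrA.
Qed.

Lemma qg_scaleAr (a : rat) (u v : QG) : a *: (u * v) = u * (a *: v).
Proof.
apply/ffunP => x; rewrite !ffunE scaler_sumr; apply: eq_bigr => y _.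
by rewrite ffunE [RHS]mulrCA.
Qed.

HB.instance Definition _ := GRing.Lmodule_isLalgebra.Build rat QG qg_scaleAl.
HB.instance Definition _ := GRing.Lalgebra_isAlgebra.Build rat QG qg_scaleAr.

Lemma qgM (g h : gT) : qg g * qg h = qg (g * h)%g.
Proof.
apply/ffunP => x; rewrite !ffunE (bigD1 g) //= big1 ?addr0.
  by rewrite !ffunE eqxx mul1r -(inj_eq (mulgI g)) mulKVg.
by move=> y /negPf yg; rewrite ffunE yg mul0r.
Qed.
End GroupRing.

Section SpanMatrix.
Variables (gT : finGroupType) (S T : finGroupoid).
Variables (H : functor S (BG gT)) (V : functor T (BG gT)) (M : gspan H V).

(* The function c\eps/d on the objects of c\M/d. *)
Definition hofib_eps (c : S) (d : T) (x : hofib (legL M) (legR M) c d) : gT :=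
  (fmap V (hofib_t x) * eps (tag x) * fmap H (hofib_s x))%g.

Definition span_matrix (rS : pi0_reps S) (rT : pi0_reps T)
    (c : pi0 S) (d : pi0 T) : QG gT :=
  \sum_(g : gT)
    (chi (level_sub (@hofib_eps (rS c) (rT d)) g) * chi (obj_sub (rT d)))
      *: qg g.
End SpanMatrix.

(* Main.v *)
(** Morphisms out of an object lift uniquely along [c\M/d -> M] and along
    [M1 x_T M2 -> M1 x M2].  Writing the Euler characteristic of a groupoid as
    the sum over all objects [x] of the inverse of the number of morphisms out
    of [x] therefore makes both sides explicit sums over objects of [M1] and
    [M2] and over morphisms.  They agree because a morphism of [T] factors
    through the representative [d] of its isomorphism class in exactly
    [|T(d,d)|] ways; commutativity of [G] reconciles the order of the
    factors. *)
Require Import Defs.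
From mathcomp Require Import all_boot all_order all_algebra all_fingroup.
(* Reimported because [hom] is shadowed by the one of [vector]. *)
Import Defs.
Set Implicit Arguments.
Unset Strict Implicit.
Unset Printing Implicit Defensive.
Import GRing.Theory Num.Theory.
Local Open Scope ring_scope.
Local Open Scope groupoid_scope.

Definition outdeg (S : finGroupoid) (a : S) : nat :=
  (\sum_(b : S) #|hom a b|)%N.

Section EulerCharacteristic.
Variable S : finGroupoid.

Lemma gcompKV (a b c : S) (f : hom a b) :
  cancel (fun g : hom b c => g \oo f) (fun g => g \oo ginv f).
Proof. by move=> g; rewrite -gcompA gcompmV gcompm1. Qed.

Lemma gcompK (a b c : S) (f : hom a b) :
  cancel (fun g : hom a c => g \oo ginv f) (fun g => g \oo f).
Proof. by move=> g; rewrite -gcompA gcompVm gcompm1. Qed.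

Lemma isob_hom (a b : S) : hom a b -> isob a b.
Proof. by move=> f; apply/existsP; exists f. Qed.

Lemma card_hom_isob (a b : S) : isob a b -> #|hom a b| = #|hom a a|.
Proof.
rewrite isob_sym => /existsP[f _].
apply: (@bij_eq_card _ _ (fun g => f \oo g)).
exists (fun g => ginv f \oo g) => g.
  by rewrite gcompA gcompVm gcomp1m.
by rewrite gcompA gcompmV gcomp1m.
Qed.

Lemma card_hom_not_isob (a b : S) : ~~ isob a b -> #|hom a b| = 0%N.
Proof.
move=> nab; apply: eq_card0 => f; apply/negbTE.
by apply: contra nab => _; apply: isob_hom f.
Qed.

Lemma outdegE (a : S) : outdeg a = (#|isob a| * #|hom a a|)%N.
Proof.
rewrite /outdeg (bigID (isob a)) /= [X in (_ + X)%N]big1 => [|b]; last first.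
  exact: card_hom_not_isob.
rewrite addn0 (eq_bigr (fun=> #|hom a a|)) => [|b]; last exact: card_hom_isob.
by rewrite sum_nat_const.
Qed.

Lemma card_aut_gt0 (a : S) : (0 < #|hom a a|)%N.
Proof. by apply/card_gt0P; exists (gid a). Qed.

(** Every object of a class [C] with automorphism group [A] has out-degree [|C| |A|], so the [|C|]
    objects of the class contribute [1/|A|] together. *)
Lemma chi_outdeg : chi S = \sum_(a : S) (outdeg a)%:R^-1.
Proof.
rewrite (partition_big (\pi_(pi0 S))%qT xpredT) //=; apply: eq_bigr => c _.
set r := generic_quotient.repr c.
have piE a : (\pi_(pi0 S)%qT a == c) = isob r a.
  by rewrite isob_sym -{1}(reprK c) (pi0_eq_quot (S := S)).
rewrite (eq_bigl _ _ piE).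
have outE a : isob r a -> outdeg a = (#|isob r| * #|hom r r|)%N.
  move=> ra; rewrite outdegE (card_aut ra); congr (_ * _)%N.
  apply: eq_card => b; rewrite !unfold_in; apply/idP/idP.
    exact: isob_trans.
  by apply: isob_trans; rewrite isob_sym.
rewrite (eq_bigr (fun=> (#|isob r| * #|hom r r|)%:R^-1)); last first.
  by move=> a /outE ->.
rewrite sumr_const natrM invfM -mulrnAl -[_ *+ _]mulr_natr mulVf ?mul1r //.
rewrite pnatr_eq0 -lt0n; apply/card_gt0P; exists r; exact: isob_refl.
Qed.

End EulerCharacteristic.

Section BigSigma.
Variables (R : Type) (idx : R) (op : Monoid.com_law idx).

Lemma big_sub_pred (I : finType) (P : pred I) (F : I -> R) :
  \big[op/idx]_(x : {x | P x}) F (val x) = \big[op/idx]_(x | P x) F x.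
Proof. exact: esym (big_sub P F). Qed.

Lemma big_tag (I : finType) (J : I -> finType) (F : {i : I & J i} -> R) :
  \big[op/idx]_p F p = \big[op/idx]_i \big[op/idx]_(j : J i) F (Tagged J j).
Proof.
rewrite (sig_big_dep xpredT (fun _ => xpredT) (fun i j => F (Tagged J j))) /=.
by apply: eq_bigr => -[].
Qed.

End BigSigma.

(** No morphism leaves [P], so out-degrees in the full subgroupoid are those in [S]. *)
Lemma chi_fullsub (S : finGroupoid) (P : pred S) :
    (forall a b : S, hom a b -> P a -> P b) ->
  chi (fullsub P) = \sum_(a | P a) (outdeg a)%:R^-1.
Proof.
move=> Pinv; rewrite chi_outdeg -(big_sub_pred _ P (fun a => (outdeg a)%:R^-1)).
apply: eq_bigr => -[a Pa] _ /=; congr (_%:R^-1); rewrite /outdeg.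
rewrite (big_sub_pred _ P (fun b => #|hom a b|)) [RHS](bigID P) /=.
rewrite [X in (_ + X)%N]big1 ?addn0 // => b nPb; apply: eq_card0 => f.
by apply/negbTE; apply: contra nPb => _; apply: Pinv f Pa.
Qed.

(** [chi_fullsub] does not apply: a single object need not be closed under isomorphism. *)
Lemma chi_obj_sub (T : finGroupoid) (d : T) :
  chi (obj_sub d) = #|hom d d|%:R^-1.
Proof.
have sum1 R idx (op : Monoid.com_law idx) (F : T -> R) :
    \big[op/idx]_(x : {x | pred1 d x}) F (val x) = F d.
  by rewrite big_sub_pred big_pred1_eq.
transitivity (\sum_(x : {x | pred1 d x}) #|hom (val x) (val x)|%:R^-1 : rat).
  rewrite chi_outdeg; apply: eq_bigr => -[x xd] _; congr (_%:R^-1).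
  rewrite /outdeg (sum1 _ _ _ (fun y => #|hom x y|)) /=.
  by move: xd => /= /eqP <-.
exact: (sum1 _ _ _ (fun x => #|hom x x|%:R^-1)).
Qed.

Lemma card_sig_sum (I : finType) (P : pred I) :
  #|{: {x | P x}}| = (\sum_x P x)%N.
Proof.
rewrite card_sig -sum1_card big_mkcond /=; apply: eq_bigr => x _.
by rewrite unfold_in; case: (P x).
Qed.

Lemma outdeg_hofib (S T M : finGroupoid) (L : functor M S) (R : functor M T)
    (c : S) (d : T) (x : hofib L R c d) :
  outdeg x = outdeg (tag x).
Proof.
case: x => a [s t] /=; rewrite /outdeg big_tag; apply: eq_bigr => b _.
under eq_bigr do rewrite card_sig_sum /=.
rewrite exchange_big -sum1_card; apply: eq_bigr => m _ /=.
(* Unique lifting: [m] forces both components of the target triple. *)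
rewrite (bigD1 (fmap L m \oo s, t \oo ginv (fmap R m))) //= big1.
  by rewrite /hofib_mor eqxx gcompK eqxx.
move=> [s' t']; apply: contraNeq; rewrite eqb0 negbK.
rewrite /hofib_mor /hofib_s /hofib_t /=.
by move=> /andP[/eqP <- /eqP ->]; rewrite gcompKV.
Qed.

Lemma outdeg_hopb (T M1 M2 : finGroupoid) (R1 : functor M1 T)
    (L2 : functor M2 T) (x : hopb R1 L2) :
  outdeg x = (outdeg (hopb_1 x) * outdeg (hopb_2 x))%N.
Proof.
case: x => -[a1 a2] t; rewrite /hopb_1 /hopb_2 /= /outdeg big_tag.
rewrite big_distrlr pair_bigA; apply: eq_bigr => -[b1 b2] _ /=.
under eq_bigr do rewrite card_sig_sum /hopb_1 /hopb_2 /=.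
rewrite exchange_big -card_prod -sum1_card; apply: eq_bigr => -[m1 m2] _ /=.
(* The pair [(m1, m2)] forces the middle morphism of the target. *)
rewrite (bigD1 (fmap L2 m2 \oo t \oo ginv (fmap R1 m1))) //= big1.
  by rewrite /hopb_mor /hopb_t /= gcompK eqxx.
move=> u; apply: contraNeq; rewrite eqb0 negbK /hopb_mor /hopb_t /=.
by move=> /eqP <-; rewrite gcompKV.
Qed.

(** Only the class of [x] contributes. For its representative [d], each [p] makes [q \oo p] run once
    through [hom x y], and the number of such [p] is [|T(d,d)|], which cancels the weight. *)
Lemma sum_factor (R : lmodType rat) (T : finGroupoid) (r : pi0_reps T)
    (x y : T) (F : hom x y -> R) :
  \sum_(d : pi0 T) \sum_(p : hom x (r d)) \sum_(q : hom (r d) y)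
     #|hom (r d) (r d)|%:R^-1 *: F (q \oo p)
  = \sum_t F t.
Proof.
pose d0 := (\pi_(pi0 T) x)%qT.
have isoE d : isob x (r d) = (d == d0).
  by rewrite -(pi0_eq_quot (S := T)) repK eq_sym.
rewrite (bigD1 d0) //= [X in _ + X]big1 ?addr0; last first.
  move=> d; rewrite -isoE => nxd; apply: big1 => p _.
  by rewrite (isob_hom p) in nxd.
have xd0 : isob x (r d0) by rewrite isoE.
under eq_bigr => p _.
  rewrite -scaler_sumr -(reindex (fun q => q \oo p) (P := xpredT) (F := F)).
    over.
  apply: onW_bij; exists (fun t => t \oo ginv p).
    exact: gcompKV.
  exact: gcompK.
rewrite sumr_const scalerMnl (card_hom_isob xd0) (card_aut xd0).
by rewrite -[_ *+ _]mulr_natr mulVf ?scale1r // pnatr_eq0 -lt0n card_aut_gt0.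
Qed.

Section SpanMatrixSum.
Variables (gT : finGroupType) (S T : finGroupoid).
Variables (H : functor S (BG gT)) (V : functor T (BG gT)) (M : gspan H V).

(** By naturality of [eps]; this closure of level sets under morphisms is what [chi_fullsub]
    requires. *)
Lemma hofib_eps_inv (c : S) (d : T) (x y : hofib (legL M) (legR M) c d) :
  hom x y -> hofib_eps x = hofib_eps y.
Proof.
move=> [m /andP[/eqP mL /eqP mR]]; rewrite /hofib_eps -mL mR !fmap_comp /=.
by have /= e := eps_nat m; rewrite !mulgA -(mulgA _ _ (eps _)) -e !mulgA.
Qed.

Lemma span_matrixE (rS : pi0_reps S) (rT : pi0_reps T) (c : pi0 S)
    (d : pi0 T) :
  span_matrix M rS rT c d
  = \sum_(a : M) \sum_(s : hom (rS c) (legL M a))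
    \sum_(t : hom (legR M a) (rT d))
      ((outdeg a)%:R^-1 * #|hom (rT d) (rT d)|%:R^-1)
        *: qg (fmap V t * eps a * fmap H s)%g.
Proof.
pose w (x : hofib (legL M) (legR M) (rS c) (rT d)) : rat :=
  (outdeg (tag x))%:R^-1 * #|hom (rT d) (rT d)|%:R^-1.
transitivity (\sum_x w x *: qg (hofib_eps x)).
  (* Grouping the objects of the fibre by their value [g] recovers the sum over the group. *)
  rewrite [RHS](partition_big (@hofib_eps _ _ _ _ _ _ _ _) xpredT) //=.
  apply: eq_bigr => g _; rewrite chi_obj_sub chi_fullsub /=; last first.
    by move=> x y /hofib_eps_inv ->.
  rewrite mulr_suml scaler_suml; apply: eq_bigr => x /eqP <-.
  by rewrite outdeg_hofib.
rewrite big_tag; apply: eq_bigr => a _.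
by rewrite pair_bigA; apply: eq_bigr => -[s t].
Qed.

End SpanMatrixSum.

Theorem theorem3p7 (gT : finGroupType) (abG : abelian [set: gT])
    (S1 T S2 : finGroupoid)
    (H1 : functor S1 (BG gT)) (V1 : functor T (BG gT))
    (V2 : functor S2 (BG gT))
    (M1 : gspan H1 V1) (M2 : gspan V1 V2)
    (r1 : pi0_reps S1) (rT : pi0_reps T) (r2 : pi0_reps S2)
    (c1 : pi0 S1) (c2 : pi0 S2) :
  span_matrix (gspan_comp M1 M2) r1 r2 c1 c2
  = \sum_(d : pi0 T) span_matrix M1 r1 rT c1 d * span_matrix M2 rT r2 d c2.
Proof.
(* Commutativity enters here: the composite puts the second span's factor on the left, the matrix
   product on the right. *)
have qgC (g h : gT) : qg g * qg h = qg (h * g)%g.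
  by rewrite qgM; congr qg; apply: (centsP abG); rewrite inE.
rewrite span_matrixE big_tag.
under [RHS]eq_bigr do rewrite !span_matrixE big_distrlr.
rewrite [RHS]exchange_big; under [RHS]eq_bigr do rewrite exchange_big.
rewrite [RHS]pair_bigA; apply: eq_bigr => -[a1 a2] _ /=.
(* The middle morphism of the pull-back splits as [q \oo p] through [rT d]. The weight introduced is
   the factor [chi (obj_sub (rT d))] of the first matrix; [p] and [q] become fibre components of
   [M1] and [M2]. *)
rewrite -(sum_factor rT); apply: eq_bigr => d _.
rewrite [X in _ = X * _]exchange_big big_distrlr.
apply: eq_bigr => p _; apply: eq_bigr => q _.
rewrite big_distrlr scaler_sumr; apply: eq_bigr => s _.
rewrite scaler_sumr; apply: eq_bigr => u _.
rewrite /= -scalerAl -scalerAr !scalerA qgC outdeg_hopb natrM invfM.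
by rewrite mulrCA -mulrACA /gspan_comp_eps /hopb_t /= fmap_comp !mulgA.
Qed.
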